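(* Let $X\in G$ and $Y,Z\in USS(X)$ with $\ell(Y)>0$. Then there is an oriented path $(g_1,\ldots,g_s,b_1,\ldots,b_t)$ in $\Gamma_X$ from $Y$ to $Z$ such that $(g_1,\ldots,g_s)$ is a (possibly empty) grey path and $(b_1,\ldots,b_t)$ is a (possibly empty) black path. Moreover, if $Z=Y^\alpha$ with $\alpha\in P$, the path can be chosen so that $g_1\cdots g_s b_1\cdots b_t=\alpha$.
   Context: $G$ is a Garside group: it has a lattice order $\preccurlyeq$ invariant under left multiplication ($a\preccurlyeq b$ iff $a^{-1}b\in P$, where $P=\{p\in G:1\preccurlyeq p\}$), with meet $\wedge$; there is a Garside element $\Delta\in P$ such that $[1,\Delta]$ is finite and generates $G$ and $\Delta^{-1}P\Delta=P$; and $P$ is atomic. Elements of $[1,\Delta]$ are simple. $\tau(x)=\Delta^{-1}x\Delta$; $X^a=a^{-1}Xa$. Left normal form $X=\Delta^p x_1\cdots x_r$: $p$ maximal with $\Delta^p\preccurlyeq X$, each $x_i\neq 1$ the maximal simple prefix of $x_i\cdots x_r$; $\inf X=p$, $\sup X=p+r$, $\ell(X)=r$. $\iota(X)=\tau^{-p}(x_1)$ if $r>0$, $\iota(\Delta^p)=1$. $\mathbf c(X)=X^{\iota(X)}$. $SSS(X)$: conjugates of $X$ of maximal infimum and minimal supremum; $USS(X)$: those $Y\in SSS(X)$ with $\mathbf c^m(Y)=Y$ for some $m>0$. A minimal simple element for $Y\in USS(X)$ is a simple $s\neq1$ with $Y^s\in USS(X)$ such that no prefix $t\ne1$, $t\neq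 s$ of $s$ has $Y^t\in USS(X)$. $\Gamma_X$ is the directed graph with vertex set $USS(X)$ and an arrow labeled $s$ from $Y$ to $Y^s$ for each $Y\in USS(X)$ and each minimal simple element $s$ for $Y$. An arrow $s$ starting at $Y$ is black if $s\preccurlyeq\iota(Y)$ and grey if $s\preccurlyeq\iota(Y^{-1})$. An oriented path is a sequence of arrows, each starting at the endpoint of the previous one; it is black (grey) if all its arrows are black (grey). *)

(* Defs.v *)
From Stdlib Require Import ZArith List.
Import ListNotations.
Open Scope Z_scope.

(* A group with a distinguished submonoid-defining predicate P; the prefix
   order is a <= b iff a^-1 b \in P. *)
Record GarsideGroup := {
  T : Type;
  mul : T -> T -> T;
  inv : T -> T;
  one : T;
  mulA : forall a b c, mul a (mul b c) = mul (mul a b) c;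
  mul1g : forall a, mul one a = a;
  mulg1 : forall a, mul a one = a;
  mulVg : forall a, mul (inv a) a = one;
  mulgV : forall a, mul a (inv a) = one;
  P : T -> Prop;
  meet : T -> T -> T;
  Delta : T;
  prec_refl : forall a, P (mul (inv a) a);
  prec_trans : forall a b c, P (mul (inv a) b) -> P (mul (inv b) c) -> P (mul (inv a) c);
  prec_antisym : forall a b, P (mul (inv a) b) -> P (mul (inv b) a) -> a = b;
  meet_l : forall a b, P (mul (inv (meet a b)) a);
  meet_r : forall a b, P (mul (inv (meet a b)) b);
  meet_glb : forall a b c, P (mul (inv c) a) -> P (mul (inv c) b) -> P (mul (inv c) (meet a b));
  join_ex : forall a b, exists j, P (mul (inv a) j) /\ P (mul (inv b) j) /\
      forall c, P (mul (inv a) c) -> P (mul (inv b) c) -> P (mul (inv j) c);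
  Delta_P : P Delta;
  simples_finite : exists l : list T, forall s,
      P (mul (inv one) s) -> P (mul (inv s) Delta) -> In s l;
  simples_generate : forall g, exists l : list (bool * T),
      (forall bs, In bs l -> P (mul (inv one) (snd bs)) /\ P (mul (inv (snd bs)) Delta)) /\
      g = fold_right (fun (bs : bool * T) (acc : T) => mul (if fst bs then snd bs else inv (snd bs)) acc) one l;
  Delta_conj_P : forall p, P p <-> P (mul (mul (inv Delta) p) Delta);
  P_atomic : forall a, P a -> exists N : nat, forall l : list T,
      (forall x, In x l -> P x /\ x <> one) -> fold_right mul one l = a ->
      (length l <= N)%nat
}.

Section Defs.
Variable G : GarsideGroup.
Local Notation T := (T G).
Local Notation "a * b" := (mul G a b).
Local Notation "1" := (one G).

Definition prec (a b : T) : Prop := P G (inv G a * b).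

Definition simple (s : T) : Prop := prec 1 s /\ prec s (Delta G).

Definition conj (X a : T) : T := inv G a * X * a.

Fixpoint npow (x : T) (n : nat) : T :=
  match n with O => 1 | S n => x * npow x n end.

Definition zpow (x : T) (z : Z) : T :=
  match z with
  | Z0 => 1
  | Zpos p => npow x (Pos.to_nat p)
  | Zneg p => inv G (npow x (Pos.to_nat p))
  end.

Definition Dpow (p : Z) : T := zpow (Delta G) p.

Definition tau_pow (k : Z) (x : T) : T := conj x (Dpow k).

Definition prod (l : list T) : T := fold_right (mul G) 1 l.

Definition LNF (X : T) (p : Z) (xs : list T) : Prop :=
  prec (Dpow p) X /\ ~ prec (Dpow (p + 1)) X /\
  X = Dpow p * prod xs /\
  forall i, (i < length xs)%nat ->
    nth i xs 1 <> 1 /\ simple (nth i xs 1) /\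
    (forall s, simple s -> prec s (prod (skipn i xs)) -> prec s (nth i xs 1)).

Definition inf_is (X : T) (p : Z) : Prop := exists xs, LNF X p xs.
Definition sup_is (X : T) (q : Z) : Prop :=
  exists p xs, LNF X p xs /\ q = p + Z.of_nat (length xs).
Definition len_is (X : T) (r : nat) : Prop := exists p xs, LNF X p xs /\ r = length xs.

Definition iota_is (X : T) (i : T) : Prop :=
  exists p xs, LNF X p xs /\
    match xs with
    | [] => i = 1
    | x1 :: _ => i = tau_pow (- p) x1
    end.

Definition cyc (X Y : T) : Prop := exists i, iota_is X i /\ Y = conj X i.

Fixpoint cyc_iter (m : nat) (X Y : T) : Prop :=
  match m with
  | O => X = Y
  | S m => exists W, cyc X W /\ cyc_iter m W Y
  end.

Definition conjugate (X Y : T) : Prop := exists a, Y = conj X a.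

Definition SSS (X Y : T) : Prop :=
  conjugate X Y /\
  forall W, conjugate X W ->
    (forall p p', inf_is W p -> inf_is Y p' -> p <= p') /\
    (forall q q', sup_is W q -> sup_is Y q' -> q' <= q).

Definition USS (X Y : T) : Prop :=
  SSS X Y /\ exists m, (0 < m)%nat /\ cyc_iter m Y Y.

Definition minimal_simple (X Y s : T) : Prop :=
  simple s /\ s <> 1 /\ USS X (conj Y s) /\
  forall t, prec 1 t -> prec t s -> t <> 1 -> t <> s -> ~ USS X (conj Y t).

(* arrow labeled s starting at Y in Gamma_X (ending at Y^s) *)
Definition arrow (X Y s : T) : Prop := USS X Y /\ minimal_simple X Y s.

Definition black_arrow (X Y s : T) : Prop :=
  arrow X Y s /\ exists i, iota_is Y i /\ prec s i.

Definition grey_arrow (X Y s : T) : Prop :=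
  arrow X Y s /\ exists i, iota_is (inv G Y) i /\ prec s i.

Inductive opath (E : T -> T -> Prop) : T -> list T -> T -> Prop :=
  | opath_nil : forall Y, opath E Y [] Y
  | opath_cons : forall Y s l Z, E Y s -> opath E (conj Y s) l Z ->
      opath E Y (s :: l) Z.

End Defs.

(* Main.v *)
(** Writing [p = inf] and [q = sup] on the super summit set, the initial factors of [Y] and
[Y^-1] are the meets [Y D^-p /\ D] and [Y^-1 D^q /\ D], where [D] is the Garside element; all of
the proof is lattice computation with these. Transport along cycling preserves meets and is
periodic on positive conjugators between elements of USS, so these conjugators are closed under
meets. Both initial factors conjugate USS into itself (for [Y^-1] because the two cyclings
commute formally), and every arrow of a path inside one of them stays inside it. Given a positive
[a] with [Y^a] in USS, peel off [iota (Y^-1) /\ a] until it is trivial: this is the grey path.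
Then [Y a] and [D^q] meet in [Y], which forces [a /\ D] to be a prefix of [iota Y]; peeling it off
gives black arrows and preserves the condition. *)

Require Import Defs.
From Stdlib Require Import ZArith List Lia Classical Wf_nat FinFun.
Import ListNotations.

Section Garside.
Context {G : GarsideGroup}.
Local Notation T := (T G).
Local Notation "a * b" := (mul G a b).
Local Notation "1" := (one G).
Local Notation "a ^-1" := (inv G a) (at level 3, left associativity, format "a ^-1").
Local Notation D := (Dpow G).
Local Notation "a <<= b" := (prec G a b) (at level 70).
Local Notation P := (P G).
Local Notation "a /^ b" := (meet G a b) (at level 45, left associativity).

Implicit Types (a b c x y : T) (p q k : Z).

(** * Group identities and powers of the Garside element *)

Lemma mulKg a x : a^-1 * (a * x) = x.
Proof. now rewrite mulA, mulVg, mul1g. Qed.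

Lemma mulVKg a x : a * (a^-1 * x) = x.
Proof. now rewrite mulA, mulgV, mul1g. Qed.

Lemma mul_cancel_l a x y : a * x = a * y -> x = y.
Proof. intro E. rewrite <- (mulKg a x), E. apply mulKg. Qed.

Lemma invK a : a^-1^-1 = a.
Proof. apply (mul_cancel_l (a^-1)). now rewrite mulgV, mulVg. Qed.

Lemma inv1 : 1^-1 = 1.
Proof. apply (mul_cancel_l 1). now rewrite mulgV, mul1g. Qed.

Lemma invM a b : (a * b)^-1 = b^-1 * a^-1.
Proof.
  apply (mul_cancel_l (a * b)). rewrite mulgV, <- mulA.
  now rewrite (mulA _ b), mulgV, mul1g, mulgV.
Qed.

Lemma npow_comm x n : npow G x n * x = x * npow G x n.
Proof.
  induction n; simpl.
  - now rewrite mul1g, mulg1.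
  - now rewrite <- mulA, IHn.
Qed.

Lemma zpow_of_nat x n : zpow G x (Z.of_nat n) = npow G x n.
Proof.
  destruct n; [reflexivity|]. cbn [Z.of_nat zpow].
  now rewrite SuccNat2Pos.id_succ.
Qed.

Lemma zpow_opp_of_nat x n : zpow G x (- Z.of_nat n) = (npow G x n)^-1.
Proof.
  destruct n; [symmetry; apply inv1|].
  cbn [Z.of_nat Z.opp zpow]. now rewrite SuccNat2Pos.id_succ.
Qed.

Lemma Dpow_succ k : D (k + 1) = D k * Delta G.
Proof.
  unfold Dpow. destruct (Z_le_gt_dec 0 k) as [H|H].
  - destruct (Z_of_nat_complete k H) as [n ->].
    replace (Z.of_nat n + 1)%Z with (Z.of_nat (S n)) by lia.
    rewrite !zpow_of_nat. symmetry. apply npow_comm.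
  - destruct (Z_of_nat_complete (- k - 1)) as [n Hn]; [lia|].
    replace (k + 1)%Z with (- Z.of_nat n)%Z by lia.
    replace k with (- Z.of_nat (S n))%Z by lia.
    rewrite !zpow_opp_of_nat. cbn [npow].
    now rewrite invM, <- mulA, mulVg, mulg1.
Qed.

Lemma Dpow0 : D 0 = 1.
Proof. reflexivity. Qed.

Lemma DpowD p q : D (p + q) = D p * D q.
Proof.
  assert (Hn : forall n, D (p + Z.of_nat n) = D p * D (Z.of_nat n)).
  { induction n.
    - change (Z.of_nat 0) with 0%Z. now rewrite Z.add_0_r, Dpow0, mulg1.
    - replace (Z.of_nat (S n)) with (Z.of_nat n + 1)%Z by lia.
      now rewrite Z.add_assoc, !Dpow_succ, IHn, mulA. }
  destruct (Z_le_gt_dec 0 q) as [H|H].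
  - destruct (Z_of_nat_complete q H) as [n ->]. apply Hn.
  - destruct (Z_of_nat_complete (- q)) as [n Hq]; [lia|].
    replace q with (- Z.of_nat n)%Z by lia. clear q H Hq.
    assert (Hm : forall m p, D (p - Z.of_nat m) * D (Z.of_nat m) = D p).
    { intro m. induction m; intro p'.
      - change (Z.of_nat 0) with 0%Z. now rewrite Z.sub_0_r, Dpow0, mulg1.
      - replace (Z.of_nat (S m)) with (1 + Z.of_nat m)%Z at 2 by lia.
        replace (D (1 + Z.of_nat m)) with (Delta G * D (Z.of_nat m)).
        2:{ unfold Dpow. replace (1 + Z.of_nat m)%Z with (Z.of_nat (S m)) by lia.
            now rewrite !zpow_of_nat. }
        rewrite mulA, <- Dpow_succ.
        replace (p' - Z.of_nat (S m) + 1)%Z with (p' - Z.of_nat m)%Z by lia.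
        apply IHm. }
    (* At [p = 0], [Hm] says that [D (- n)] is the inverse of [D n]. *)
    assert (E := Hm n p). assert (E0 := Hm n 0%Z).
    replace (p + - Z.of_nat n)%Z with (p - Z.of_nat n)%Z by lia.
    replace (- Z.of_nat n)%Z with (0 - Z.of_nat n)%Z by lia.
    rewrite Dpow0 in E0.
    replace (D (0 - Z.of_nat n)) with ((D (Z.of_nat n))^-1).
    2:{ rewrite <- (mul1g G ((D (Z.of_nat n))^-1)), <- E0, <- mulA, mulgV. apply mulg1. }
    now rewrite <- E, <- mulA, mulgV, mulg1.
Qed.

Lemma Dpow1 : D 1 = Delta G.
Proof. exact (mulg1 G (Delta G)). Qed.

Lemma DpowV k : (D k)^-1 = D (- k).
Proof.
  apply (mul_cancel_l (D k)).
  now rewrite mulgV, <- DpowD, Z.add_opp_diag_r.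
Qed.

Lemma DpowDK p q x : D p * (D q * x) = D (p + q) * x.
Proof. now rewrite DpowD, mulA. Qed.

Hint Rewrite <- (mulA G) Dpow1 DpowD : garside.
Hint Rewrite (mul1g G) (mulg1 G) (mulVg G) (mulgV G) mulKg mulVKg invK inv1 invM
  DpowV DpowDK : garside.

Ltac Dpow_zero :=
  match goal with
  | |- context [Dpow G ?e] =>
      first [ progress replace (Dpow G e) with (one G)
                by (replace e with 0%Z by lia; reflexivity) ]
  end.

Ltac gsimp := unfold conj; repeat (autorewrite with garside; try Dpow_zero).
Ltac group :=
  gsimp; repeat first [reflexivity | lia | f_equal].

(** Derives a positivity goal from the positivity hypothesis [H] when both elements have the same
    reduced form in the group. *)
Ltac from H := let E := type of H in
  unfold prec in *;
  match goal with |- P ?x => refine (eq_ind _ P H x _) end; group.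

(** * The prefix order and its translations *)

Lemma prec_one a : 1 <<= a <-> P a.
Proof. unfold prec. now rewrite inv1, mul1g. Qed.

Lemma preccE a b : a <<= b -> P (a^-1 * b).
Proof. exact (fun H => H). Qed.

Lemma precc a : a <<= a.
Proof. apply prec_refl. Qed.

Lemma prec_tr a b c : a <<= b -> b <<= c -> a <<= c.
Proof. apply prec_trans. Qed.

Lemma prec_anti a b : a <<= b -> b <<= a -> a = b.
Proof. apply prec_antisym. Qed.

Lemma prec_mul2l c a b : c * a <<= c * b <-> a <<= b.
Proof. split; intro H; from H. Qed.

Lemma P1 : P 1.
Proof. apply prec_one, precc. Qed.

Lemma prec_mulr a b : P b -> a <<= a * b.
Proof. intro H. from H. Qed.

Lemma P_mul a b : P a -> P b -> P (a * b).
Proof.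
  intros Ha Hb. apply prec_one. apply prec_tr with a.
  - now apply prec_one.
  - now apply prec_mulr.
Qed.

(** [Delta_conj_P] is an equivalence, so its iterates, read backwards, also cover negative [k]. *)
Lemma P_conj_Dpow k a : P a -> P (D (- k) * a * D k).
Proof.
  revert a.
  assert (H1 : forall a, P a <-> P (D (-1) * a * D 1)).
  { intro a. rewrite (Delta_conj_P G a), <- Dpow1, DpowV. reflexivity. }
  assert (Hn : forall n a, P a <-> P (D (- Z.of_nat n) * a * D (Z.of_nat n))).
  { induction n; intro a.
    - change (Z.of_nat 0) with 0%Z. rewrite !Dpow0, mul1g, mulg1. reflexivity.
    - rewrite H1, IHn.
      replace (D (- Z.of_nat n) * (D (-1) * a * D 1) * D (Z.of_nat n))
        with (D (- Z.of_nat (S n)) * a * D (Z.of_nat (S n))) by group.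
      reflexivity. }
  intros a Ha. destruct (Z_le_gt_dec 0 k) as [H|H].
  - destruct (Z_of_nat_complete k H) as [n ->]. now apply Hn.
  - destruct (Z_of_nat_complete (- k)) as [n Hk]; [lia|].
    apply (Hn n). from Ha.
Qed.

(** The order is left invariant by construction; on the right, powers of [Delta G] preserve it
    because conjugation by them preserves [P]. *)
Lemma prec_mulDr k a b : a * D k <<= b * D k <-> a <<= b.
Proof.
  assert (H : forall k a b, a <<= b -> a * D k <<= b * D k).
  { clear. intros k a b H. apply (P_conj_Dpow k) in H. from H. }
  split; [|apply H]. intro E. apply (H (- k)%Z) in E. from E.
Qed.

Lemma P_Delta : P (Delta G).
Proof. apply Delta_P. Qed.

Lemma Dpow_le p q : (p <= q)%Z -> D p <<= D q.
Proof.
  intro H. replace q with (p + Z.of_nat (Z.to_nat (q - p)))%Z by lia.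
  generalize (Z.to_nat (q - p)). clear.
  intro n. induction n as [|n IHn].
  - rewrite Z.add_0_r. apply precc.
  - apply prec_tr with (1 := IHn).
    replace (D (p + Z.of_nat (S n))) with (D (p + Z.of_nat n) * Delta G).
    + apply prec_mulr, P_Delta.
    + rewrite <- Dpow1. group.
Qed.

Lemma prec_mull_Dpow k a : P a -> D k <<= a * D k.
Proof.
  intro H. rewrite <- (mul1g G (D k)) at 1. now apply prec_mulDr, prec_one.
Qed.

(** * Meets and their compatibility with translations *)

Lemma meet_lel a b : a /^ b <<= a.
Proof. apply meet_l. Qed.

Lemma meet_ler a b : a /^ b <<= b.
Proof. apply meet_r. Qed.

Lemma le_meet a b c : c <<= a -> c <<= b -> c <<= a /^ b.
Proof. apply meet_glb. Qed.

Lemma meet_eq a b m : m <<= a -> m <<= b ->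
  (forall c, c <<= a -> c <<= b -> c <<= m) -> a /^ b = m.
Proof.
  intros Ha Hb H. apply prec_anti.
  - apply H; [apply meet_lel|apply meet_ler].
  - now apply le_meet.
Qed.

Lemma meet_mono a b c d : a <<= b -> c <<= d -> a /^ c <<= b /^ d.
Proof.
  intros H1 H2. apply le_meet.
  - apply prec_tr with a; [apply meet_lel|exact H1].
  - apply prec_tr with c; [apply meet_ler|exact H2].
Qed.

Lemma meetC a b : a /^ b = b /^ a.
Proof.
  apply meet_eq; [apply meet_ler|apply meet_lel|].
  intros c H1 H2. now apply le_meet.
Qed.

Lemma meetA a b c : a /^ (b /^ c) = a /^ b /^ c.
Proof.
  apply meet_eq.
  - apply prec_tr with (a /^ b); [apply meet_lel|apply meet_lel].
  - apply meet_mono; [apply meet_ler|apply precc].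
  - intros d H1 H2. apply le_meet; [apply le_meet; [exact H1|]|];
      apply prec_tr with (1 := H2); [apply meet_lel|apply meet_ler].
Qed.

Lemma meetACA a b c d : (a /^ b) /^ (c /^ d) = (a /^ c) /^ (b /^ d).
Proof. now rewrite !meetA, <- (meetA a b c), (meetC b c), meetA. Qed.

Lemma mul_meet c a b : c * (a /^ b) = c * a /^ c * b.
Proof.
  symmetry. apply meet_eq.
  - apply prec_mul2l, meet_lel.
  - apply prec_mul2l, meet_ler.
  - intros d H1 H2. rewrite <- (mulVKg c d) in *.
    apply prec_mul2l. apply prec_mul2l in H1, H2. now apply le_meet.
Qed.

Lemma meet_mulD k a b : (a /^ b) * D k = a * D k /^ b * D k.
Proof.
  symmetry. apply meet_eq.
  - apply prec_mulDr, meet_lel.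
  - apply prec_mulDr, meet_ler.
  - intros d H1 H2. replace d with (d * D (- k) * D k) in * by group.
    apply prec_mulDr. apply prec_mulDr in H1, H2. now apply le_meet.
Qed.

Lemma P_meet a b : P a -> P b -> P (a /^ b).
Proof. intros. apply prec_one, le_meet; now apply prec_one. Qed.

(** * Powers of the Garside element as bounds, and finite intervals *)

(** Induction on a word in the simples: a positive letter raises the upper exponent by one, an
    inverse letter lowers the lower exponent by one. *)
Lemma Dpow_bounds a : exists k m, D k <<= a /\ a <<= D m.
Proof.
  destruct (simples_generate G a) as [l [Hl ->]].
  induction l as [|[e s] l IH].
  - exists 0%Z, 0%Z. split; apply precc.
  - destruct IH as (k & m & Hk & Hm).
    { intros bs Hbs. apply Hl. now right. }
    destruct (Hl (e, s) (or_introl eq_refl)) as [Hs Hs']. cbn [snd] in *.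
    cbn [fold_right fst snd].
    set (x := fold_right _ _ _) in *. clearbody x.
    destruct e.
    + exists k, (1 + m)%Z. split.
      * apply prec_tr with (s * D k).
        -- apply prec_mull_Dpow. now apply prec_one.
        -- now apply prec_mul2l.
      * apply prec_tr with (s * D m).
        -- now apply prec_mul2l.
        -- rewrite DpowD, Dpow1. rewrite <- Dpow1 in *. now apply prec_mulDr.
    + exists (-1 + k)%Z, m. split.
      * apply prec_tr with (s^-1 * D k).
        -- rewrite DpowD. apply prec_mulDr.
           apply preccE, (P_conj_Dpow (-1)) in Hs'. from Hs'.
        -- now apply prec_mul2l.
      * apply prec_tr with (s^-1 * D m).
        -- now apply prec_mul2l.
        -- rewrite <- (mul1g G (D m)) at 2. apply prec_mulDr.
           from Hs.
Qed.

Lemma le_Dpow_nat a : exists n, a <<= D (Z.of_nat n).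
Proof.
  destruct (Dpow_bounds a) as (k & m & _ & H). exists (Z.to_nat m).
  apply prec_tr with (1 := H), Dpow_le. lia.
Qed.

Lemma meet_Dpow_step a k : a <<= a * Delta G -> a /^ D (k + 1) <<= (a /^ D k) * Delta G.
Proof.
  intro H. rewrite <- Dpow1, meet_mulD, <- DpowD. apply meet_mono; [|apply precc].
  now rewrite Dpow1.
Qed.

(** By [meet_Dpow_step], a trivial meet with [Delta G] forces a trivial meet with every power, and
    some power lies above [a]. Hence each nontrivial positive element has a nontrivial simple prefix
    to peel off. *)
Lemma meet_Delta_one a : P a -> a /^ Delta G = 1 -> a = 1.
Proof.
  intros Ha H.
  assert (Hn : forall n, a /^ D (Z.of_nat n) = 1).
  { induction n as [|n IH].
    - apply meet_eq; [now apply prec_one|apply precc|auto].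
    - rewrite Nat2Z.inj_succ, <- Z.add_1_r.
      assert (E := meet_Dpow_step a (Z.of_nat n) (prec_mulr a _ P_Delta)).
      rewrite IH, mul1g in E. rewrite <- H.
      apply prec_anti.
      + apply le_meet; [apply meet_lel|exact E].
      + apply meet_mono; [apply precc|]. rewrite <- Dpow1. apply Dpow_le. lia. }
  destruct (le_Dpow_nat a) as [n Hle]. rewrite <- (Hn n). symmetry.
  apply meet_eq; [apply precc|exact Hle|auto].
Qed.

(** [(a /^ Delta G) * D k] is the meet of [a * D k] and [D (k + 1)], both above [a]. *)
Lemma meet_Delta_tail a k : P a -> (0 <= k)%Z -> a <<= D (k + 1) ->
  (a /^ Delta G)^-1 * a <<= D k.
Proof.
  intros Ha Hk H. apply (prec_mul2l (a /^ Delta G)). rewrite mulVKg.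
  rewrite meet_mulD, <- Dpow1, <- DpowD. apply le_meet.
  - rewrite <- (mulg1 G a) at 1. now apply prec_mul2l, (Dpow_le 0).
  - now rewrite Z.add_comm.
Qed.

(** Splitting off the simple head [a /^ Delta G] leaves a tail in the interval below the previous
    power. *)
Lemma interval_finite n : exists l, forall a, P a -> a <<= D (Z.of_nat n) -> In a l.
Proof.
  induction n as [|n [l Hl]].
  - exists [1]. intros a Ha H. left. apply prec_anti; [now apply prec_one|exact H].
  - destruct (simples_finite G) as [s Hs].
    exists (flat_map (fun x => map (mul G x) l) s). intros a Ha H.
    rewrite Nat2Z.inj_succ, <- Z.add_1_r in H.
    apply meet_Delta_tail in H; [|exact Ha|lia].
    apply in_flat_map. exists (a /^ Delta G). split.
    + apply Hs; [|apply meet_ler]. apply prec_one, P_meet; [exact Ha|apply P_Delta].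
    + apply in_map_iff. exists ((a /^ Delta G)^-1 * a). split; [apply mulVKg|].
      apply Hl; [apply meet_lel|exact H].
Qed.

Lemma pigeonhole (f : nat -> T) (l : list T) : (forall n, In (f n) l) ->
  exists i j, (i < j)%nat /\ f i = f j.
Proof.
  intro H. apply NNPP. intro Hn.
  assert (Hinj : forall i j, f i = f j -> i = j).
  { intros i j E. destruct (lt_eq_lt_dec i j) as [[L|L]|L]; [|exact L|];
      exfalso; apply Hn; eauto. }
  assert (Hl := NoDup_incl_length (l := map f (seq 0 (S (length l)))) (l' := l)).
  rewrite length_map, length_seq in Hl.
  enough (S (length l) <= length l)%nat by lia. apply Hl.
  - apply Injective_map_NoDup; [exact Hinj|apply seq_NoDup].
  - intros x Hx. apply in_map_iff in Hx. destruct Hx as (i & <- & _). apply H.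
Qed.

(** * Factorisation length as an induction measure *)

(** The atomicity bound on factorisations into nontrivial positive elements. It drops when a
    nontrivial positive prefix or suffix is removed, so every peeling argument below is an induction
    on [N]. *)
Definition bounded a (N : nat) := forall l,
  (forall x, In x l -> P x /\ x <> 1) -> fold_right (mul G) 1 l = a -> (length l <= N)%nat.

Lemma bounded_tail a b N : P a -> a <> 1 -> P b -> bounded (a * b) N ->
  exists N', N = S N' /\ bounded b N'.
Proof.
  intros Ha Ha1 Hb H.
  assert (Hl : forall l, (forall x, In x l -> P x /\ x <> 1) ->
    fold_right (mul G) 1 l = b -> (S (length l) <= N)%nat).
  { intros l Hl E. apply (H (a :: l)).
    - intros x [<-|Hx]; auto.
    - cbn. now rewrite E. }
  destruct N as [|N].
  (* [N = 0] is impossible: [b] factors as [[]] or as [[b]], and [a] in front makes the length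
     positive. *)
  - exfalso. destruct (classic (b = 1)) as [E|E].
    + specialize (Hl [] (fun x (F : In x []) => match F with end) (eq_sym E)). cbn in Hl. lia.
    + enough (S (length [b]) <= 0)%nat by lia. apply Hl; [|apply mulg1].
      intros x [<-|[]]. auto.
  - exists N. split; [reflexivity|]. intros l H1 H2. specialize (Hl l H1 H2). lia.
Qed.

Lemma bounded_head a b N : P a -> P b -> b <> 1 -> bounded (a * b) N ->
  exists N', N = S N' /\ bounded a N'.
Proof.
  intros Ha Hb Hb1 H.
  assert (Hl : forall l, (forall x, In x l -> P x /\ x <> 1) ->
    fold_right (mul G) 1 l = a -> (S (length l) <= N)%nat).
  { intros l Hl E. specialize (H (l ++ [b])). rewrite length_app in H. cbn in H.
    rewrite Nat.add_1_r in H. apply H.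
    - intros x Hx. apply in_app_or in Hx. destruct Hx as [Hx|[<-|[]]]; auto.
    - rewrite <- E. clear. induction l as [|x l IH]; cbn.
      + now rewrite mulg1, mul1g.
      + now rewrite IH, mulA. }
  destruct N as [|N].
  - exfalso. destruct (classic (a = 1)) as [E|E].
    + specialize (Hl [] (fun x (F : In x []) => match F with end) (eq_sym E)). cbn in Hl. lia.
    + enough (S (length [a]) <= 0)%nat by lia. apply Hl; [|apply mulg1].
      intros x [<-|[]]. auto.
  - exists N. split; [reflexivity|]. intros l H1 H2. specialize (Hl l H1 H2). lia.
Qed.

(** * Left normal forms *)

Lemma simple_spec a : simple G a <-> P a /\ a <<= Delta G.
Proof. unfold simple. now rewrite prec_one. Qed.

(** The last clause of [LNF], isolated from the power of [Delta G] so that it passes to tails. *)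
Definition normal (xs : list T) := forall i, (i < length xs)%nat ->
  nth i xs 1 <> 1 /\ simple G (nth i xs 1) /\
  (forall s, simple G s -> s <<= prod G (skipn i xs) -> s <<= nth i xs 1).

(** Maximality of the head among simple prefixes identifies it with a meet. This requires the meet
    itself to be simple, so positivity of the tail is proved in the same induction. *)
Lemma normal_cons_inv x xs : normal (x :: xs) ->
  normal xs /\ P (prod G xs) /\ x <> 1 /\ simple G x /\ prod G (x :: xs) /^ Delta G = x.
Proof.
  revert x. induction xs as [|y xs IH]; intros x H.
  - assert (H0 := H 0%nat Nat.lt_0_1). cbn in H0. destruct H0 as (H1 & H2 & H3).
    split; [intros i Hi; cbn in Hi; lia|]. split; [apply P1|]. do 2 (split; [assumption|]).
    cbn. rewrite mulg1. apply meet_eq; [apply precc|apply H2|auto].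
  - assert (Hn : normal (y :: xs)).
    { intros i Hi. apply (H (S i)). cbn in *. lia. }
    assert (H0 := H 0%nat (Nat.lt_0_succ _)). cbn [nth skipn] in H0.
    destruct H0 as (H1 & H2 & H3).
    assert (HP : P (prod G (y :: xs))).
    { destruct (IH y Hn) as (_ & Hp & _ & Hy & _). apply P_mul; [|exact Hp].
      now apply simple_spec. }
    do 4 (split; [assumption|]). apply meet_eq.
    + now apply prec_mulr.
    + apply H2.
    + intros c Hc1 Hc2.
      apply prec_tr with (prod G (x :: y :: xs) /^ Delta G); [now apply le_meet|].
      apply H3; [|apply meet_lel]. apply simple_spec. split; [|apply meet_ler].
      apply P_meet; [|apply P_Delta]. apply P_mul; [|exact HP]. now apply simple_spec.
Qed.

Lemma normal_P xs : normal xs -> P (prod G xs).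
Proof.
  destruct xs as [|x xs]; intro H; [apply P1|].
  destruct (normal_cons_inv x xs H) as (_ & Hp & _ & Hx & _).
  apply P_mul; [|exact Hp]. now apply simple_spec.
Qed.

Lemma normal_le xs : normal xs -> prod G xs <<= D (Z.of_nat (length xs)).
Proof.
  induction xs as [|x xs IH]; intro H; [apply precc|].
  destruct (normal_cons_inv x xs H) as (Hn & Hp & _ & Hx & _).
  apply simple_spec in Hx.
  cbn [prod fold_right length]. apply prec_tr with (x * D (Z.of_nat (length xs))).
  - now apply prec_mul2l, IH.
  - replace (Z.of_nat (S (length xs))) with (1 + Z.of_nat (length xs))%Z by lia.
    rewrite DpowD, Dpow1. now apply prec_mulDr.
Qed.

(** By [meet_Delta_tail], removing the head lowers the exponent by one; at the end the last factor
    would lie below [1]. *)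
Lemma normal_nle xs : normal xs -> xs <> [] -> ~ prod G xs <<= D (Z.of_nat (length xs) - 1).
Proof.
  induction xs as [|x xs IH]; intros H Hne Hle; [now apply Hne|].
  assert (HP := normal_P _ H).
  destruct (normal_cons_inv x xs H) as (Hn & Hp & Hx1 & Hx & Hm).
  replace (Z.of_nat (length (x :: xs)) - 1)%Z with (Z.of_nat (length xs)) in Hle by (cbn [length]; lia).
  destruct xs as [|y xs].
  - apply Hx1. rewrite <- Hm. cbn in *. apply meet_eq.
    + now apply prec_one.
    + apply prec_one, P_Delta.
    + intros c Hc _. now apply prec_tr with (1 := Hc).
  - apply (IH Hn); [discriminate|].
    replace (Z.of_nat (length (y :: xs))) with (Z.of_nat (length (y :: xs)) - 1 + 1)%Z in Hle by lia.
    apply meet_Delta_tail in Hle; [|exact HP|cbn [length]; lia].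
    rewrite Hm in Hle. cbn [prod fold_right] in Hle. now rewrite mulKg in Hle.
Qed.

Lemma normal_exists a : P a -> exists xs, normal xs /\ a = prod G xs.
Proof.
  intro Ha. destruct (P_atomic G a Ha) as [N HN]. change (bounded a N) in HN.
  revert a Ha HN. induction N as [N IH] using lt_wf_ind; intros a Ha HN.
  destruct (classic (a = 1)) as [->|Ha1].
  { exists []. split; [intros i Hi; cbn in Hi; lia|reflexivity]. }
  set (x := a /^ Delta G).
  assert (Hx : P x) by (apply P_meet; [exact Ha|apply P_Delta]).
  assert (Hx1 : x <> 1) by (intro E; now apply Ha1, meet_Delta_one).
  rewrite <- (mulVKg x a) in HN.
  destruct (bounded_tail x (x^-1 * a) N Hx Hx1 (meet_lel _ _) HN) as (N' & -> & HN').
  destruct (IH N' (Nat.lt_succ_diag_r _) _ (meet_lel _ _) HN') as (xs & Hxs & E).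
  assert (Ea : a = prod G (x :: xs)).
  { cbn [prod fold_right]. change (fold_right _ _ _) with (prod G xs). now rewrite <- E, mulVKg. }
  exists (x :: xs). split; [|exact Ea].
  intros [|i] Hi.
  - cbn [nth skipn]. rewrite <- Ea. split; [exact Hx1|]. split.
    + apply simple_spec. split; [exact Hx|apply meet_ler].
    + intros s Hs Hsa. apply le_meet; [exact Hsa|apply Hs].
  - apply (Hxs i). cbn in Hi. lia.
Qed.

Lemma LNF_normal W p xs : LNF G W p xs ->
  D p <<= W /\ ~ D (p + 1) <<= W /\ W = D p * prod G xs /\ normal xs.
Proof. exact (fun H => H). Qed.

Lemma LNF_nle W p xs : LNF G W p xs -> ~ W <<= D (p + Z.of_nat (length xs) - 1).
Proof.
  intros H Hle. apply LNF_normal in H. destruct H as (Hp & Hp1 & E & Hn).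
  destruct xs as [|x xs].
  (* With no factors, [D p <<= W <<= D (p - 1)]; shifting by [D 1] gives
     [D (p + 1) <<= D p <<= W]. *)
  - apply Hp1. cbn [length] in Hle.
    assert (H1 := prec_tr _ _ _ Hp Hle).
    apply (prec_mulDr 1) in H1. rewrite <- !DpowD in H1.
    apply prec_tr with (1 := H1). apply prec_tr with (2 := Hp), Dpow_le. lia.
  - apply (normal_nle (x :: xs) Hn); [discriminate|].
    apply (prec_mul2l (D p)). rewrite <- E, <- DpowD.
    apply prec_tr with (1 := Hle), Dpow_le. lia.
Qed.

Lemma LNF_le W p xs : LNF G W p xs -> W <<= D (p + Z.of_nat (length xs)).
Proof.
  intro H. apply LNF_normal in H. destruct H as (_ & _ & E & Hn).
  rewrite E, DpowD. now apply prec_mul2l, normal_le.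
Qed.

Lemma Dpow_le_nprec p q W : D p <<= W -> ~ D (q + 1) <<= W -> (p <= q)%Z.
Proof.
  intros H1 H2. destruct (Z_le_gt_dec p q) as [H|H]; [exact H|]. exfalso.
  apply H2, prec_tr with (2 := H1), Dpow_le. lia.
Qed.

Lemma le_Dpow_nprec p q W : W <<= D q -> ~ W <<= D (p - 1) -> (p <= q)%Z.
Proof.
  intros H1 H2. destruct (Z_le_gt_dec p q) as [H|H]; [exact H|]. exfalso.
  apply H2, prec_tr with (1 := H1), Dpow_le. lia.
Qed.

Lemma LNF_exists W : Delta G <> 1 -> exists p xs, LNF G W p xs.
Proof.
  intro HD.
  assert (Hmax : exists p, D p <<= W /\ ~ D (p + 1) <<= W).
  { destruct (Dpow_bounds W) as (k & m & Hk & Hm).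
    apply NNPP. intro Hn.
    assert (Hall : forall n, D (k + Z.of_nat n) <<= W).
    { induction n as [|n IH]; [now rewrite Z.add_0_r|].
      apply NNPP. intro H. apply Hn. exists (k + Z.of_nat n)%Z. split; [exact IH|].
      now rewrite <- Z.add_assoc, Z.add_1_r, <- Nat2Z.inj_succ. }
    (* The chosen exponent is at least [m + 1]; comparing with [D m] forces [Delta G <<= 1]. *)
    assert (H := prec_tr _ _ _ (Hall (Z.to_nat (m + 1 - k))) Hm).
    apply HD, prec_anti; [|apply prec_one, P_Delta].
    apply (prec_mulDr (- m)) in H. rewrite <- !DpowD, Z.add_opp_diag_r in H.
    apply prec_tr with (2 := H). rewrite <- Dpow1. apply Dpow_le. lia. }
  destruct Hmax as (p & H1 & H2).
  destruct (normal_exists (D (- p) * W)) as (xs & Hn & E).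
  { apply preccE in H1. from H1. }
  exists p, xs. split; [exact H1|]. split; [exact H2|]. split; [|exact Hn].
  rewrite <- E. group.
Qed.

(** * Inverses and initial factors *)

(** The quotients [a^-1 * D k] and [D k * a^-1] are conjugate by a power of [Delta G]. Thus an upper
    bound on an element is a lower bound on its inverse. *)
Lemma le_Dpow_inv k a : a <<= D k <-> D (- k) <<= a^-1.
Proof.
  split; intro H.
  - apply preccE, (P_conj_Dpow (- k)) in H. from H.
  - apply preccE, (P_conj_Dpow k) in H. from H.
Qed.

(* For [inf W = p] this is the initial factor; on an inverse with [p = - sup] it is the
   initial factor of the inverse. *)
Definition init p W := (W * D (- p)) /^ Delta G.

(** The first factor is [prod G xs /^ Delta G]. Conjugation by [D (- p)] respects meets, fixes
    [Delta G] and sends [prod G xs] to [W * D (- p)]. *)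
Lemma iota_is_init W p i : Delta G <> 1 -> D p <<= W -> ~ D (p + 1) <<= W ->
  iota_is G W i <-> i = init p W.
Proof.
  intros HD H1 H2.
  assert (Hi : forall p' xs, LNF G W p' xs -> p' = p /\
    init p W = match xs with [] => 1 | x1 :: _ => tau_pow G (- p') x1 end).
  { intros p' xs H. apply LNF_normal in H. destruct H as (H3 & H4 & E & Hn).
    assert (p' = p) as ->.
    { apply Z.le_antisymm; [now apply Dpow_le_nprec with W|now apply Dpow_le_nprec with W]. }
    split; [reflexivity|]. unfold init. destruct xs as [|x xs].
    - replace (W * D (- p)) with 1 by (rewrite E; cbn; group).
      apply meet_eq; [apply precc|apply prec_one, P_Delta|auto].
    - apply normal_cons_inv in Hn. destruct Hn as (_ & _ & _ & _ & Hm).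
      unfold tau_pow. rewrite <- Hm. unfold conj. rewrite mul_meet, meet_mulD.
      f_equal; [rewrite E|]; group. }
  split.
  - intros (p' & xs & H & E). destruct (Hi _ _ H) as [-> ->]. destruct xs; exact E.
  - intros ->. destruct (LNF_exists W HD) as (p' & xs & H).
    exists p', xs. split; [exact H|]. destruct (Hi _ _ H) as [-> ->]. now destruct xs.
Qed.

(** * Cycling and transport *)

(** Cycling as a function for a fixed infimum [p]; on the super summit set it agrees with the
    relation [cyc]. *)
Definition cycl p W := conj G W (init p W).

(* The transport of [a] along cycling, [init p Y ^-1 * a * init p (conj Y a)], written so
   that compatibility with meets is visible. *)
Definition transport p Y a := (init p Y)^-1 * ((Y * a * D (- p)) /^ a * Delta G).

Lemma conjM Y a b : conj G (conj G Y a) b = conj G Y (a * b).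
Proof. group. Qed.

Lemma conj1 Y : conj G Y 1 = Y.
Proof. group. Qed.

Lemma mul_init_conj p Y a :
  a * init p (conj G Y a) = (Y * a * D (- p)) /^ a * Delta G.
Proof. unfold init. rewrite mul_meet. f_equal. group. Qed.

Lemma transportE p Y a : transport p Y a = (init p Y)^-1 * a * init p (conj G Y a).
Proof. unfold transport. now rewrite <- mul_init_conj, mulA. Qed.

Lemma conj_transport p Y a : conj G (cycl p Y) (transport p Y a) = cycl p (conj G Y a).
Proof.
  rewrite transportE. unfold cycl. rewrite !conjM. f_equal. now rewrite !mulA, mulgV, mul1g.
Qed.

(** [a] occurs in [transport] only through left translates and right translates by powers of
    [Delta G], all of which distribute over meets. *)
Lemma transport_meet p Y a b : transport p Y (a /^ b) = transport p Y a /^ transport p Y b.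
Proof.
  unfold transport. rewrite <- mul_meet. f_equal.
  rewrite mul_meet, <- Dpow1, !meet_mulD. apply meetACA.
Qed.

(** Together with monotonicity, this keeps transports of [a] inside any interval between powers of
    [Delta G] that contains [a]. *)
Lemma transport_Dpow p Y k : transport p Y (D k) = D k.
Proof.
  unfold transport. apply (mul_cancel_l (init p Y)). rewrite mulVKg.
  unfold init. rewrite meet_mulD. f_equal; group.
Qed.

Fixpoint transportn p n Y a :=
  match n with O => a | S n => transportn p n (cycl p Y) (transport p Y a) end.

Fixpoint initn p n Y :=
  match n with O => 1 | S n => init p Y * initn p n (cycl p Y) end.

(** The product telescopes. The right factor depends on [a] only through [conj G Y a], which is what
    makes transport injective once that conjugate is fixed. *)
Lemma transportnE p n Y a :
  transportn p n Y a = (initn p n Y)^-1 * a * initn p n (conj G Y a).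
Proof.
  revert Y a. induction n as [|n IH]; intros Y a; cbn.
  - group.
  - rewrite IH, conj_transport, transportE. rewrite invM, !mulA. reflexivity.
Qed.

Lemma conj_transportn p n Y a :
  conj G (Nat.iter n (cycl p) Y) (transportn p n Y a) = Nat.iter n (cycl p) (conj G Y a).
Proof.
  revert Y a. induction n as [|n IH]; intros Y a; [reflexivity|].
  rewrite !Nat.iter_succ_r. cbn [transportn]. now rewrite IH, conj_transport.
Qed.

Lemma transportn_meet p n Y a b :
  transportn p n Y (a /^ b) = transportn p n Y a /^ transportn p n Y b.
Proof.
  revert Y a b. induction n as [|n IH]; intros Y a b; [reflexivity|].
  cbn. now rewrite transport_meet, IH.
Qed.

Lemma transportn_Dpow p n Y k : transportn p n Y (D k) = D k.
Proof.
  revert Y. induction n as [|n IH]; intro Y; [reflexivity|].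
  cbn. now rewrite transport_Dpow, IH.
Qed.

Lemma meet_absorb a b : a <<= b <-> a /^ b = a.
Proof.
  split; intro H.
  - apply meet_eq; auto using precc.
  - rewrite <- H. apply meet_ler.
Qed.

Lemma meet_mono_map (f : T -> T) : (forall a b, f (a /^ b) = f a /^ f b) ->
  forall a b, a <<= b -> f a <<= f b.
Proof. intros Hf a b H. apply meet_absorb. apply meet_absorb in H. now rewrite <- Hf, H. Qed.

(* On the set of [b] with [conj Y b = conj Y a], transport around a common cycling period is
   [b |-> C^-1 * b * C'] with constant [C, C'], hence injective; being also a map of a finite
   interval, it is periodic there. *)
Lemma transportn_periodic p M Y a :
  Nat.iter M (cycl p) Y = Y -> Nat.iter M (cycl p) (conj G Y a) = conj G Y a ->
  P a -> exists N, (0 < N)%nat /\ Nat.iter N (transportn p M Y) a = a.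
Proof.
  intros HY HYa Ha. set (F := transportn p M Y).
  destruct (le_Dpow_nat a) as [n Hn].
  destruct (interval_finite n) as [l Hl].
  assert (Hmono : forall b c, b <<= c -> F b <<= F c).
  { apply meet_mono_map. intros. apply transportn_meet. }
  assert (HF : forall i, P (Nat.iter i F a) /\ Nat.iter i F a <<= D (Z.of_nat n) /\
    conj G Y (Nat.iter i F a) = conj G Y a).
  { induction i as [|i (IH1 & IH2 & IH3)]; [auto|]. rewrite Nat.iter_succ. split; [|split].
    - apply prec_one. rewrite <- Dpow0, <- (transportn_Dpow p M Y 0). apply Hmono.
      now apply prec_one.
    - rewrite <- (transportn_Dpow p M Y (Z.of_nat n)). now apply Hmono.
    - rewrite <- HY at 1. unfold F at 1. rewrite conj_transportn, IH3. exact HYa. }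
  destruct (pigeonhole (fun i => Nat.iter i F a) l) as (i & j & Hij & E).
  { intro i. apply Hl; apply HF. }
  exists (j - i)%nat. split; [lia|].
  replace j with (i + (j - i))%nat in E by lia.
  (* The equality is stripped of one round at a time: both iterates conjugate [Y] to the same
     element, so the outer factors agree and cancel. *)
  revert E. generalize (j - i)%nat. clear Hij. intro d. induction i as [|i IH]; intro E; [now symmetry|].
  apply IH. cbn [Nat.add] in E. rewrite !Nat.iter_succ in E. unfold F at 1 3 in E. rewrite !transportnE in E.
  fold F in E. rewrite (proj2 (proj2 (HF i))), (proj2 (proj2 (HF (i + d)%nat))) in E.
  rewrite <- !mulA in E. apply mul_cancel_l in E.
  set (c := initn p M _) in E. clearbody c.
  rewrite <- (mulg1 G (Nat.iter i F a)), <- (mulg1 G (Nat.iter (i + d) F a)).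
  now rewrite <- (mulgV G c), !mulA, E.
Qed.

(** * The ultra summit set in lattice terms *)

(** Infimum at least [p] and supremum at most [q], free of normal forms. For the summit values [p]
    and [q] it cuts the super summit set out of the conjugacy class. *)
Definition box p q W := D p <<= W /\ W <<= D q.

Definition periodic p W := exists m, (0 < m)%nat /\ Nat.iter m (cycl p) W = W.

Definition ultra X p q W := conjugate G X W /\ box p q W /\ periodic p W.

Lemma conjugate_conj X W a : conjugate G X W -> conjugate G X (conj G W a).
Proof. intros [b ->]. exists (b * a). apply conjM. Qed.

Lemma Dpow_le_conj k Y a : D k <<= conj G Y a <-> a * D k <<= Y * a.
Proof.
  rewrite <- (prec_mul2l a). replace (a * conj G Y a) with (Y * a) by group. reflexivity.
Qed.

Lemma conj_le_Dpow k Y a : conj G Y a <<= D k <-> Y * a <<= a * D k.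
Proof.
  rewrite <- (prec_mul2l a). replace (a * conj G Y a) with (Y * a) by group. reflexivity.
Qed.

(** Multiplied by the conjugator, each bound compares its left translate by [Y] with its right
    translate by a power of [Delta G], and both translations commute with meets. *)
Lemma box_meet p q Y a b : box p q (conj G Y a) -> box p q (conj G Y b) ->
  box p q (conj G Y (a /^ b)).
Proof.
  intros [Ha Ha'] [Hb Hb']. split.
  - apply Dpow_le_conj. apply Dpow_le_conj in Ha, Hb.
    rewrite meet_mulD, mul_meet. now apply meet_mono.
  - apply conj_le_Dpow. apply conj_le_Dpow in Ha', Hb'.
    rewrite meet_mulD, mul_meet. now apply meet_mono.
Qed.

Lemma box_inv p q W : box p q W -> box (- q) (- p) (W^-1).
Proof.
  intros [H1 H2]. split.
  - now apply le_Dpow_inv.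
  - apply le_Dpow_inv. now rewrite invK, Z.opp_involutive.
Qed.

Lemma P_init p W : D p <<= W -> P (init p W).
Proof.
  intro H. apply P_meet; [|apply P_Delta].
  apply prec_one. apply (prec_mulDr p). replace (W * D (- p) * D p) with W by group.
  now rewrite mul1g.
Qed.

Lemma init_Delta p W : init p W <<= Delta G.
Proof. apply meet_ler. Qed.

Lemma prec_mul_Delta a : a <<= a * Delta G.
Proof. apply prec_mulr, P_Delta. Qed.

(** Lower bound: [init p W * D p] is a prefix of [W]. Upper bound: [W * init p W] is compared with
    the two halves of the meet [init p W * D q], using [init p W <<= W * D (- p)] for one and
    [init p W <<= Delta G] for the other. *)
Lemma box_cycl p q W : box p q W -> box p q (cycl p W).
Proof.
  intros [H1 H2]. assert (HP := P_init p W H1). split.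
  - apply Dpow_le_conj. apply prec_tr with (2 := prec_mulr W _ HP).
    unfold init. apply prec_tr with (W * D (- p) * D p).
    + apply prec_mulDr, meet_lel.
    + replace (W * D (- p) * D p) with W by group. apply precc.
  - apply conj_le_Dpow. unfold init at 2. rewrite meet_mulD. apply le_meet.
    + rewrite <- mulA. apply prec_mul2l. apply prec_tr with (1 := meet_lel _ _).
      apply (prec_mulDr p). replace (W * D (- p) * D p) with W by group.
      apply prec_tr with (1 := H2). replace (D (- p) * D q * D p) with (D q) by group.
      apply precc.
    + apply prec_tr with (W * Delta G).
      * apply prec_mul2l, init_Delta.
      * rewrite <- Dpow1. apply (prec_mulDr 1) in H2. apply prec_tr with (1 := H2).
        replace (D q * D 1) with (D 1 * D q) by group. apply precc.
Qed.

Lemma iter_mul (f : T -> T) m n x : Nat.iter m f x = x -> Nat.iter (n * m)%nat f x = x.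
Proof.
  intro H. induction n as [|n IH]; [reflexivity|].
  cbn [Nat.mul]. now rewrite Nat.iter_add, IH.
Qed.

(** Around a common cycling period [M], transport fixes [a] after [na] rounds and [b] after [nb].
    After [na * nb] rounds it fixes both, hence their meet, and so that many rounds of cycling fix
    the conjugate by the meet. *)
Lemma periodic_meet p Y a b : P a -> P b -> periodic p Y ->
  periodic p (conj G Y a) -> periodic p (conj G Y b) -> periodic p (conj G Y (a /^ b)).
Proof.
  intros Ha Hb (m & Hm & HY) (ma & Hma & HYa) (mb & Hmb & HYb).
  set (M := (m * ma * mb)%nat).
  assert (EY : Nat.iter M (cycl p) Y = Y).
  { replace M with (ma * mb * m)%nat by (unfold M; lia). now apply iter_mul. }
  assert (EYa : Nat.iter M (cycl p) (conj G Y a) = conj G Y a).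
  { replace M with (m * mb * ma)%nat by (unfold M; lia). now apply iter_mul. }
  assert (EYb : Nat.iter M (cycl p) (conj G Y b) = conj G Y b).
  { now apply iter_mul. }
  destruct (transportn_periodic p M Y a EY EYa Ha) as (na & Hna & Ena).
  destruct (transportn_periodic p M Y b EY EYb Hb) as (nb & Hnb & Enb).
  set (F := transportn p M Y) in *.
  assert (EF : Nat.iter (na * nb) F (a /^ b) = a /^ b).
  { assert (Hm' : forall n, Nat.iter n F (a /^ b) = Nat.iter n F a /^ Nat.iter n F b).
    { induction n as [|n IH]; [reflexivity|].
      rewrite !Nat.iter_succ, IH. apply transportn_meet. }
    rewrite Hm'. f_equal; [rewrite Nat.mul_comm|]; now apply iter_mul. }
  assert (Hc : forall n, conj G Y (Nat.iter n F (a /^ b)) =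
    Nat.iter (n * M) (cycl p) (conj G Y (a /^ b))).
  { induction n as [|n IH]; [reflexivity|].
    rewrite Nat.iter_succ. cbn [Nat.mul]. rewrite Nat.iter_add, <- IH.
    unfold F at 1. rewrite <- conj_transportn, EY. reflexivity. }
  exists (na * nb * M)%nat. split; [unfold M; lia|]. now rewrite <- Hc, EF.
Qed.

Lemma ultra_meet X p q Y a b : P a -> P b -> ultra X p q Y ->
  ultra X p q (conj G Y a) -> ultra X p q (conj G Y b) ->
  ultra X p q (conj G Y (a /^ b)).
Proof.
  intros Ha Hb (H1 & H2 & H3) (_ & Ha2 & Ha3) (_ & Hb2 & Hb3). split; [|split].
  - now apply conjugate_conj.
  - now apply box_meet.
  - now apply periodic_meet.
Qed.

Lemma ultra_cycl X p q Y : ultra X p q Y -> ultra X p q (cycl p Y).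
Proof.
  intros (H1 & H2 & m & Hm & H3). split; [|split].
  - now apply conjugate_conj.
  - now apply box_cycl.
  - exists m. split; [exact Hm|]. now rewrite <- Nat.iter_succ_r, Nat.iter_succ, H3.
Qed.

Lemma conj_inv Y a : (conj G Y a)^-1 = conj G (Y^-1) a.
Proof. group. Qed.

(* Expanding the meets, both sides conjugate [Y] by
   [D (q-p) /\ Y D (1-p) /\ Y^-1 D (q+1) /\ D 2]. *)
Lemma cycl_inv_comm p q Y :
  cycl p (cycl (- q) (Y^-1))^-1 = (cycl (- q) (cycl p Y)^-1)^-1.
Proof.
  unfold cycl. rewrite !conj_inv, !invK, !conjM. f_equal.
  rewrite mul_init_conj.
  replace (init p Y * init (- q) (conj G (Y^-1) (init p Y)))
    with ((Y^-1 * init p Y * D (- - q)) /^ init p Y * Delta G)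
    by (symmetry; apply mul_init_conj).
  unfold init. rewrite <- Dpow1, !mul_meet, !meet_mulD.
  gsimp. rewrite meetACA. repeat first [reflexivity | lia | f_equal].
Qed.

(** This conjugation is cycling of the inverse followed by inversion. It commutes with cycling, so a
    period of [Y] is a period of its image. *)
Lemma ultra_cycl_inv X p q Y : ultra X p q Y -> ultra X p q (conj G Y (init (- q) (Y^-1))).
Proof.
  intros (H1 & H2 & m & Hm & H3).
  assert (E : conj G Y (init (- q) (Y^-1)) = (cycl (- q) (Y^-1))^-1).
  { unfold cycl. now rewrite conj_inv, invK. }
  split; [|split].
  - now apply conjugate_conj.
  - rewrite E. apply box_inv, box_cycl, box_inv in H2.
    now rewrite !Z.opp_involutive in H2.
  - rewrite E. exists m. split; [exact Hm|]. rewrite <- H3 at 2. clear.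
    induction m as [|m IH]; [reflexivity|].
    now rewrite !Nat.iter_succ, IH, cycl_inv_comm.
Qed.

(** [b * init p (conj G Y b)] is the meet of [Y * b * D (- p)] and [b * Delta G], which lie above
    the two halves of [init p Y]. So after an arrow inside the initial factor, the remainder stays
    inside the new one. *)
Lemma le_init_conj p Y b b' : P b -> b * b' <<= init p Y -> b' <<= init p (conj G Y b).
Proof.
  intros Hb H. apply (prec_mul2l b). rewrite mul_init_conj. apply le_meet.
  - apply prec_tr with (1 := H), prec_tr with (1 := meet_lel _ _).
    apply prec_mulDr. now apply prec_mulr.
  - apply prec_tr with (1 := H), prec_tr with (1 := init_Delta _ _).
    rewrite <- Dpow1. now apply prec_mull_Dpow.
Qed.

(** * Minimal simple elements and paths *)

(** Passing to a proper prefix removes a nontrivial suffix, so [bounded_head] ends the descent. *)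
Lemma minimal_simple_exists X Y u : P u -> u <> 1 -> u <<= Delta G -> USS G X (conj G Y u) ->
  exists s, P s /\ s <<= u /\ minimal_simple G X Y s.
Proof.
  intros Hu. destruct (P_atomic G u Hu) as [N HN]. change (bounded u N) in HN.
  revert u Hu HN. induction N as [N IH] using lt_wf_ind; intros u Hu HN Hu1 HuD HU.
  destruct (classic (exists t, P t /\ t <<= u /\ t <> 1 /\ t <> u /\ USS G X (conj G Y t)))
    as [(t & Ht & Htu & Ht1 & Htne & HtU)|Hn].
  - rewrite <- (mulVKg t u) in HN.
    destruct (bounded_head t (t^-1 * u) N Ht Htu) as (N' & -> & HN'); [|exact HN|].
    + intro E. apply Htne. rewrite <- (mulVKg t u), E. symmetry. apply mulg1.
    + destruct (IH N' (Nat.lt_succ_diag_r _) t Ht HN' Ht1 (prec_tr _ _ _ Htu HuD) HtU)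
        as (s & Hs & Hst & Hmin).
      exists s. split; [exact Hs|]. split; [|exact Hmin]. now apply prec_tr with t.
  - exists u. split; [exact Hu|]. split; [apply precc|].
    split; [now apply simple_spec|]. split; [exact Hu1|]. split; [exact HU|].
    intros t Ht Htu Ht1 Htne HtU. apply Hn. exists t. rewrite <- prec_one. auto.
Qed.

Lemma prod_cat l l' : prod G (l ++ l') = prod G l * prod G l'.
Proof.
  induction l as [|x l IH]; cbn; [now rewrite mul1g|].
  change (fold_right _ _ ?x) with (prod G x). now rewrite IH, mulA.
Qed.

Lemma opath_cat E Y l W l' Z : opath G E Y l W -> opath G E W l' Z -> opath G E Y (l ++ l') Z.
Proof. induction 1; cbn; [auto|]. intro. constructor; auto. Qed.

Lemma opath_end E Y l W : opath G E Y l W -> W = conj G Y (prod G l).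
Proof.
  induction 1 as [Y|Y s l Z _ _ IH]; [symmetry; apply conj1|].
  now rewrite IH, conjM.
Qed.

(** Stated for an abstract [I] to serve both colours, with [I] either [init p] or [coinit q].
    Minimal arrows are split off [u] one by one; the second hypothesis keeps the rest below [I]. *)
Lemma opath_below_init X (E : T -> T -> Prop) (I : T -> T) :
  (forall Y, I Y <<= Delta G) ->
  (forall Y b b', P b -> b * b' <<= I Y -> b' <<= I (conj G Y b)) ->
  (forall Y s, arrow G X Y s -> s <<= I Y -> E Y s) ->
  forall u Y, P u -> USS G X Y -> USS G X (conj G Y u) -> u <<= I Y ->
  exists l, opath G E Y l (conj G Y u) /\ prod G l = u.
Proof.
  intros HID HIt HE u Y Hu. destruct (P_atomic G u Hu) as [N HN]. change (bounded u N) in HN.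
  revert u Y Hu HN. induction N as [N IH] using lt_wf_ind; intros u Y Hu HN HY HYu HuI.
  destruct (classic (u = 1)) as [->|Hu1].
  { exists []. rewrite conj1. split; [constructor|reflexivity]. }
  destruct (minimal_simple_exists X Y u Hu Hu1) as (s & Hs & Hsu & Hmin);
    [now apply prec_tr with (I Y)|exact HYu|].
  rewrite <- (mulVKg s u) in HN, HuI, HYu |- *. set (v := s^-1 * u) in *.
  destruct (bounded_tail s v N Hs (proj1 (proj2 Hmin)) Hsu HN) as (N' & -> & HN').
  destruct (IH N' (Nat.lt_succ_diag_r _) v (conj G Y s) Hsu HN') as (l & Hl & El).
  - apply Hmin.
  - now rewrite conjM.
  - now apply HIt.
  - exists (s :: l). rewrite conjM in Hl. split.
    + constructor; [|exact Hl]. apply HE; [now split|].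
      apply prec_tr with (2 := HuI). now apply prec_mulr.
    + cbn. change (fold_right _ _ l) with (prod G l). now rewrite El.
Qed.

Definition coinit q Y := init (- q) (Y^-1).

Definition black X p Y s := arrow G X Y s /\ s <<= init p Y.
Definition grey X q Y s := arrow G X Y s /\ s <<= coinit q Y.

(** * The grey and the black phase *)

Section Paths.
(** [p] and [q] are the summit infimum and supremum; [Hpq] expresses positive canonical length. *)
Context (X : T) (p q : Z) (Hpq : (p + 1 <= q)%Z)
  (HU : forall W, USS G X W <-> ultra X p q W).

Lemma ultra_box Y : USS G X Y -> box p q Y.
Proof. intro H. now apply HU. Qed.

Lemma P_coinit Y : USS G X Y -> P (coinit q Y).
Proof. intro H. apply P_init. exact (proj1 (box_inv p q Y (ultra_box Y H))). Qed.

Lemma coinit_conj Y b b' : P b -> b * b' <<= coinit q Y -> b' <<= coinit q (conj G Y b).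
Proof. unfold coinit. rewrite conj_inv. apply le_init_conj. Qed.

Lemma grey_phase a Y : P a -> USS G X Y -> USS G X (conj G Y a) ->
  exists gs a' W, opath G (grey X q) Y gs W /\ a = prod G gs * a' /\ P a' /\
    USS G X W /\ coinit q W /^ a' = 1.
Proof.
  intro Ha. destruct (P_atomic G a Ha) as [N HN]. change (bounded a N) in HN.
  revert a Y Ha HN. induction N as [N IH] using lt_wf_ind; intros a Y Ha HN HY HYa.
  set (u := coinit q Y /^ a).
  assert (Hu : P u) by (apply P_meet; [now apply P_coinit|exact Ha]).
  destruct (classic (u = 1)) as [E|Hu1].
  { exists [], a, Y. split; [constructor|]. split; [symmetry; apply mul1g|]. auto. }
  assert (HYu : USS G X (conj G Y u)).
  { apply HU. apply ultra_meet; [now apply P_coinit|exact Ha|now apply HU| |now apply HU].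
    now apply ultra_cycl_inv, HU. }
  destruct (opath_below_init X (grey X q) (coinit q) (fun Y => init_Delta _ _) coinit_conj
    (fun Y s H1 H2 => Logic.conj H1 H2) u Y Hu HY HYu (meet_lel _ _)) as (l & Hl & El).
  assert (Hua : u <<= a) by apply meet_ler.
  rewrite <- (mulVKg u a) in HN, HYa |- *. set (v := u^-1 * a) in *.
  destruct (bounded_tail u v N Hu Hu1 Hua HN) as (N' & -> & HN').
  destruct (IH N' (Nat.lt_succ_diag_r _) v (conj G Y u) Hua HN' HYu)
    as (gs & a' & W & Hgs & Ev & Ha' & HW & Hco).
  { now rewrite conjM. }
  exists (l ++ gs), a', W. split; [now apply opath_cat with (conj G Y u)|]. split; [|auto].
  now rewrite prod_cat, El, Ev, mulA.
Qed.

(** The trivial meet with [coinit q Y] is the invariant of the induction. Each round removes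
    [a /^ Delta G], and the invariant must be recovered at the new vertex. *)
Lemma black_phase a Y : P a -> USS G X Y -> USS G X (conj G Y a) -> coinit q Y /^ a = 1 ->
  exists bs, opath G (black X p) Y bs (conj G Y a) /\ prod G bs = a.
Proof.
  intro Ha. destruct (P_atomic G a Ha) as [N HN]. change (bounded a N) in HN.
  revert a Y Ha HN. induction N as [N IH] using lt_wf_ind; intros a Y Ha HN HY HYa Hco.
  destruct (classic (a = 1)) as [->|Ha1].
  { exists []. rewrite conj1. split; [constructor|reflexivity]. }
  destruct (ultra_box Y HY) as [Hp Hq].
  (* [Y * a] and [D q] have meet [Y]: no nontrivial prefix of [a] is absorbed by [Y]. *)
  assert (Habs : a /^ (Y^-1 * D q) = 1).
  { apply meet_Delta_one; [now apply P_meet|]. rewrite <- Hco. unfold coinit, init.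
    now rewrite Z.opp_involutive, <- meetA, meetC. }
  set (u := a /^ Delta G).
  assert (Hu : P u) by (apply P_meet; [exact Ha|apply P_Delta]).
  assert (Hu1 : u <> 1) by (intro E; now apply Ha1, meet_Delta_one).
  assert (Hua : u <<= a) by apply meet_lel.
  (* As [Y] is the meet of [Y * a] and [D q], two bounds on [u * D p] suffice: it lies below
     [a * D p <<= Y * a] since [conj G Y a] has infimum at least [p], and below [D (p + 1) <<= D q]
     by positive length. *)
  assert (HuI : u <<= init p Y).
  { apply le_meet; [|apply meet_ler]. apply (prec_mulDr p).
    replace (Y * D (- p) * D p) with (Y * 1) by group.
    rewrite <- Habs, mul_meet, mulVKg. apply le_meet.
    - apply prec_tr with (a * D p); [now apply prec_mulDr|].
      apply Dpow_le_conj. now apply ultra_box.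
    - apply prec_tr with (Delta G * D p); [apply prec_mulDr, meet_ler|].
      rewrite <- Dpow1, <- DpowD. apply Dpow_le. lia. }
  assert (HYu : USS G X (conj G Y u)).
  { replace u with (a /^ init p Y).
    - apply HU. apply ultra_meet; [exact Ha|now apply P_init|now apply HU|now apply HU|].
      now apply ultra_cycl, HU.
    - apply meet_eq; [exact Hua|exact HuI|]. intros c H1 H2. apply le_meet; [exact H1|].
      apply prec_tr with (1 := H2), init_Delta. }
  destruct (opath_below_init X (black X p) (init p) (init_Delta p) (le_init_conj p)
    (fun Y s H1 H2 => Logic.conj H1 H2) u Y Hu HY HYu HuI) as (l & Hl & El).
  assert (Ea : a = u * (u^-1 * a)) by (symmetry; apply mulVKg).
  set (v := u^-1 * a) in *.
  rewrite Ea in HN, HYa.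
  destruct (bounded_tail u v N Hu Hu1 Hua HN) as (N' & -> & HN').
  destruct (IH N' (Nat.lt_succ_diag_r _) v (conj G Y u) Hua HN' HYu) as (bs & Hbs & Ev).
  - now rewrite conjM.
  - apply meet_eq.
    + now apply prec_one, P_coinit.
    + now apply prec_one.
    (* It suffices that [u * t] is below [Delta G]: then [u * t <<= a /^ Delta G = u], so
       [t <<= 1]. *)
    + intros t Ht1 Ht2. apply (prec_mul2l u). rewrite mulg1.
      assert (Hut : u * t <<= a) by (rewrite Ea; now apply prec_mul2l).
      apply le_meet; [exact Hut|].
      (* By [Habs], [Delta G] is the meet of [a * Delta G] and [Y^-1 * D (q + 1)]. For the second,
         [Y * u * t = u * (conj G Y u * t) <<= u * D q <<= D (q + 1)]. *)
      rewrite <- (mul1g G (Delta G)), <- Habs, <- Dpow1, meet_mulD. apply le_meet.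
      * apply prec_tr with (1 := Hut). rewrite Dpow1. apply prec_mul_Delta.
      * apply (prec_mul2l Y).
        apply prec_tr with (u * D q).
        -- rewrite mulA. replace (Y * u * t) with (u * (conj G Y u * t)) by group.
           apply prec_mul2l. apply (prec_mul2l ((conj G Y u)^-1)). rewrite mulKg.
           apply prec_tr with (1 := Ht1), prec_tr with (1 := meet_lel _ _).
           rewrite Z.opp_involutive. apply precc.
        -- replace (Y * (Y^-1 * D q * D 1)) with (D 1 * D q) by group.
           apply prec_mulDr. rewrite Dpow1. apply meet_ler.
  - exists (l ++ bs). rewrite conjM in Hbs. rewrite Ea. split.
    + now apply opath_cat with (conj G Y u).
    + now rewrite prod_cat, El, Ev.
Qed.

End Paths.

(** * From normal forms to the lattice description *)

(** The normal form of one summit element fixes the extremal values for the whole class.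
    [Delta G <> 1] gives every conjugate a normal form, so the conditions in [SSS] are not
    vacuous. *)
Lemma SSS_box X Y p xs : Delta G <> 1 -> SSS G X Y -> LNF G Y p xs ->
  let q := (p + Z.of_nat (length xs))%Z in
  (forall W, conjugate G X W -> ~ D (p + 1) <<= W /\ ~ W <<= D (q - 1)) /\
  (forall W, SSS G X W <-> conjugate G X W /\ box p q W).
Proof.
  intros HD [HXY HY] HL q.
  assert (Hpq : forall W, conjugate G X W -> forall p' xs', LNF G W p' xs' ->
    (p' <= p)%Z /\ (q <= p' + Z.of_nat (length xs'))%Z).
  { intros W HW p' xs' HL'. destruct (HY W HW) as [H1 H2]. split.
    - apply H1; [now exists xs'|now exists xs].
    - apply H2; [now exists p', xs'|now exists p, xs]. }
  assert (Hn : forall W, conjugate G X W -> ~ D (p + 1) <<= W /\ ~ W <<= D (q - 1)).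
  { intros W HW. destruct (LNF_exists W HD) as (p' & xs' & HL').
    destruct (Hpq W HW p' xs' HL') as [H1 H2]. split; intro H.
    - assert (H3 := Dpow_le_nprec _ p' _ H (proj1 (proj2 HL'))). lia.
    - assert (H3 := le_Dpow_nprec _ _ _ H (LNF_nle _ _ _ HL')). lia. }
  split; [exact Hn|]. intro W. split.
  - intros [HXW HW]. split; [exact HXW|].
    destruct (LNF_exists W HD) as (p' & xs' & HL').
    destruct (HW Y HXY) as [H1 H2]. split.
    + apply prec_tr with (2 := proj1 HL'), Dpow_le. apply H1; [now exists xs|now exists xs'].
    + apply prec_tr with (1 := LNF_le _ _ _ HL'), Dpow_le.
      apply H2; [now exists p, xs|now exists p', xs'].
  - intros [HXW [H1 H2]]. split; [exact HXW|]. intros V HV. split.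
    + intros p1 p2 [xs1 HL1] [xs2 HL2].
      apply Z.le_trans with p.
      * now apply (Hpq V HV _ _ HL1).
      * exact (Dpow_le_nprec _ _ _ H1 (proj1 (proj2 HL2))).
    + intros q1 q2 (p1 & xs1 & HL1 & ->) (p2 & xs2 & HL2 & ->).
      apply Z.le_trans with q.
      * exact (le_Dpow_nprec _ _ _ H2 (LNF_nle _ _ _ HL2)).
      * now apply (Hpq V HV _ _ HL1).
Qed.

Lemma iota_init X Y p xs W i : Delta G <> 1 -> SSS G X Y -> LNF G Y p xs ->
  SSS G X W -> iota_is G W i <-> i = init p W.
Proof.
  intros HD HY HL HW. destruct (SSS_box X Y p xs HD HY HL) as [Hn HS].
  apply HS in HW. destruct HW as [HXW [H _]].
  apply iota_is_init; [exact HD|exact H|]. now apply Hn.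
Qed.

Lemma iota_inv_coinit X Y p xs W i : Delta G <> 1 -> SSS G X Y -> LNF G Y p xs ->
  SSS G X W -> iota_is G (W^-1) i <-> i = coinit (p + Z.of_nat (length xs)) W.
Proof.
  intros HD HY HL HW. destruct (SSS_box X Y p xs HD HY HL) as [Hn HS].
  apply HS in HW. destruct HW as [HXW HW].
  apply iota_is_init; [exact HD|apply (box_inv _ _ _ HW)|].
  intro H. apply (proj2 (Hn W HXW)), le_Dpow_inv.
  replace (- (p + Z.of_nat (length xs) - 1))%Z with (- (p + Z.of_nat (length xs)) + 1)%Z by lia.
  exact H.
Qed.

(** Cycling stays in the super summit set, where [iota_is] is computed by [init p]; hence [cyc_iter]
    is iteration of [cycl p]. *)
Lemma USS_ultra X Y p xs W : Delta G <> 1 -> SSS G X Y -> LNF G Y p xs ->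
  USS G X W <-> ultra X p (p + Z.of_nat (length xs)) W.
Proof.
  intros HD HY HL. destruct (SSS_box X Y p xs HD HY HL) as [_ HS].
  assert (Hc : forall m V V', SSS G X V ->
    cyc_iter G m V V' <-> Nat.iter m (cycl p) V = V').
  { induction m as [|m IH]; intros V V' HV; [reflexivity|].
    assert (HV1 : SSS G X (cycl p V)).
    { apply HS. apply HS in HV. destruct HV. split; [now apply conjugate_conj|now apply box_cycl]. }
    rewrite Nat.iter_succ_r. cbn [cyc_iter]. rewrite <- (IH _ _ HV1). split.
    - intros (U & (i & Hi & ->) & H).
      apply (iota_init X Y p xs) in Hi; [|assumption..]. now rewrite Hi in H.
    - intro H. exists (cycl p V). split; [|exact H].
      exists (init p V). split; [|reflexivity]. now apply (iota_init X Y p xs). }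
  unfold USS, ultra, periodic. split.
  - intros [HW (m & Hm & H)]. apply Hc in H; [|exact HW]. apply HS in HW.
    destruct HW. eauto.
  - intros (H1 & H2 & m & Hm & H). assert (HW : SSS G X W) by now apply HS.
    split; [exact HW|]. exists m. split; [exact Hm|]. now apply Hc.
Qed.

Lemma opath_mono (E E' : T -> T -> Prop) Y l Z :
  (forall W s, E W s -> E' W s) -> opath G E Y l Z -> opath G E' Y l Z.
Proof. intro H. induction 1; constructor; auto. Qed.

(** * Positive conjugators *)

(** The conjugates of [Z] by powers of [Delta G] all lie between [D p] and [D q], a translate of a
    finite interval, so two of them coincide. *)
Lemma conj_Dpow_fixed p q Z : box p q Z ->
  exists e, (0 < e)%nat /\ conj G Z (D (Z.of_nat e)) = Z.
Proof.
  intros [H1 H2].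
  destruct (interval_finite (Z.to_nat (q - p))) as [l Hl].
  destruct (pigeonhole (fun i => conj G Z (D (Z.of_nat i))) (map (mul G (D p)) l))
    as (i & j & Hij & E).
  - intro i. apply in_map_iff. exists (D (- p) * conj G Z (D (Z.of_nat i))).
    split; [group|]. apply Hl.
    + apply preccE, (P_conj_Dpow (Z.of_nat i)) in H1. from H1.
    + apply (prec_mul2l (D p)). apply prec_tr with (D q).
      * apply preccE, (P_conj_Dpow (Z.of_nat i)) in H2. from H2.
      * rewrite <- DpowD. apply Dpow_le. lia.
  - exists (j - i)%nat. split; [lia|].
    assert (E' : conj G (conj G Z (D (Z.of_nat i))) (D (- Z.of_nat i)) =
      conj G (conj G Z (D (Z.of_nat j))) (D (- Z.of_nat i))) by now f_equal.
    rewrite !conjM, <- !DpowD, Z.add_opp_diag_r, Dpow0, conj1 in E'.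
    rewrite E' at 2. do 2 f_equal. lia.
Qed.

Lemma positive_conjugator p q Y Z g : box p q Z -> Z = conj G Y g ->
  exists a, P a /\ Z = conj G Y a.
Proof.
  intros HZ E. destruct (conj_Dpow_fixed p q Z HZ) as (e & He & Ee).
  destruct (Dpow_bounds g) as (k & _ & Hk & _).
  (* [D k <<= g] and [e >= 1], so [k + n * e >= 0] and [g * D (n * e)] is positive. *)
  set (n := Z.to_nat (- k)).
  assert (En : forall m, conj G Z (D (Z.of_nat (m * e))) = Z).
  { induction m as [|m IH]; [apply conj1|].
    replace (Z.of_nat (S m * e)) with (Z.of_nat (m * e) + Z.of_nat e)%Z by lia.
    now rewrite DpowD, <- conjM, IH. }
  exists (g * D (Z.of_nat (n * e))). split.
  - apply prec_one. apply prec_tr with (D k * D (Z.of_nat (n * e))).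
    + rewrite <- DpowD. apply (Dpow_le 0). nia.
    + now apply prec_mulDr.
  - now rewrite <- conjM, <- E, En.
Qed.

End Garside.

Theorem mainTheorem9 (G : GarsideGroup) (X Y Z : T G) :
  USS G X Y -> USS G X Z ->
  (exists p xs, LNF G Y p xs /\ xs <> []) ->
  (exists (gs bs : list (T G)) (W : T G),
      opath G (grey_arrow G X) Y gs W /\ opath G (black_arrow G X) W bs Z) /\
  (forall alpha : T G, P G alpha -> Z = conj G Y alpha ->
    exists (gs bs : list (T G)) (W : T G),
      opath G (grey_arrow G X) Y gs W /\ opath G (black_arrow G X) W bs Z /\
      prod G (gs ++ bs) = alpha).
Proof.
  intros HY HZ (p & xs & HL & Hxs). set (q := (p + Z.of_nat (length xs))%Z).
  assert (HD : Delta G <> one G).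
  (* If [Delta G] were trivial, [D (p + 1) = D p] would contradict maximality of [p]. *)
  { intro E. apply (proj1 (proj2 HL)). rewrite Dpow_succ, E, mulg1. apply HL. }
  assert (HS := proj1 HY).
  assert (HU : forall W, USS G X W <-> ultra X p q W) by (intro W; now apply USS_ultra with Y).
  assert (Hpq : (p + 1 <= q)%Z).
  { unfold q. destruct xs; [now destruct Hxs|cbn [length]; lia]. }
  assert (Hpos : forall alpha : T G, P G alpha -> Z = conj G Y alpha ->
    exists (gs bs : list (T G)) (W : T G),
      opath G (grey_arrow G X) Y gs W /\ opath G (black_arrow G X) W bs Z /\
      prod G (gs ++ bs) = alpha).
  { intros a Ha ->.
    destruct (grey_phase X p q HU a Y Ha HY HZ) as (gs & a' & W & Hgs & -> & Ha' & HW & Hco).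
    assert (EW := opath_end _ _ _ _ Hgs).
    rewrite <- conjM, <- EW in HZ |- *.
    destruct (black_phase X p q Hpq HU a' W Ha' HW HZ Hco) as (bs & Hbs & <-).
    exists gs, bs, W. split; [|split].
    - apply opath_mono with (2 := Hgs). intros V s [Hs Hle]. split; [exact Hs|].
      exists (coinit q V). split; [|exact Hle].
      apply (iota_inv_coinit X Y p xs); trivial. apply Hs.
    - apply opath_mono with (2 := Hbs). intros V s [Hs Hle]. split; [exact Hs|].
      exists (init p V). split; [|exact Hle].
      apply (iota_init X Y p xs); trivial. apply Hs.
    - apply prod_cat. }
  split; [|exact Hpos].
  (* With [Y] and [Z] conjugate to [X] by [g] and [h], the element [g^-1 * h] conjugates [Y] to [Z];
     a positive conjugator replaces it. *)
  destruct HY as [[[g ->] _] _]. assert (HZ' := HZ). destruct HZ' as [[[h Eh] _] _].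
  destruct (positive_conjugator p q (conj G X g) Z (mul G (inv G g) h)) as (a & Ha & E).
  - now apply HU.
  - rewrite conjM, mulA, mulgV, mul1g. exact Eh.
  - destruct (Hpos a Ha E) as (gs & bs & W & H1 & H2 & _). eauto.
Qed.
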